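(* Let $P \subset \mathbb{R}^d$ be a convex polytope that $k$-tiles $\mathbb{R}^d$ with a discrete multiset $\Lambda$, and suppose that every element of $\Lambda$ is contained in a quasi-periodic set $\mathcal{Q} = \mathcal{L}_1 \cup \dots \cup \mathcal{L}_n$, where $\mathcal{L}_1,\dots,\mathcal{L}_n$ are translated lattices in $\mathbb{R}^d$. Let $\mathcal{L} = \mathcal{L}_i$ be one of these translated lattices. If $\mathcal{L}$ is in general position with respect to $\mathcal{Q}$ and $\mathcal{L} \cap \Lambda$ is non-empty, then $P$ $m$-tiles $\mathbb{R}^d$ with $\mathcal{L}$ for some positive integer $m$.
   Context: A lattice in $\mathbb{R}^d$ is the set of integer linear combinations of a basis of $\mathbb{R}^d$; a translated lattice is a set $a + \mathcal{M}$ with $a \in \mathbb{R}^d$ and $\mathcal{M}$ a lattice. A quasi-periodic set is a finite union of translated lattices, not necessarily translates of the same lattice. $\partial P$ denotes the boundary of $P$ (closure minus interior), and $A + B = \{a+b : a \in A, b \in B\}$. For a positive integer $k$, a convex polytope $P \subset \mathbb{R}^d$ $k$-tiles $\mathbb{R}^d$ with a discrete multiset $\Lambda$ of vectors in $\mathbb{R}^d$ if $\sum_{\lambda \in \Lambda} \mathbf{1}_{P+\lambda}(v) = k$ for all $v \in \mathbb{R}^d$ with $v \notin \partial P + \Lambda$ (the sum counts multiplicities; $\mathbf{1}_X$ is the indicator function of $X$). A set is regarded as a multiset with all multiplicities $1$. For a multiset $A$ and a set $S$, $A \cap S$ is the multiset of the elements of $A$ lying in $S$, with their multiplicities in $A$.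 For $\mathcal{Q}$ given as the union of the translated lattices $\mathcal{L}_1,\dots,\mathcal{L}_n$, we say that $\mathcal{L}_i$ is in general position with respect to $\mathcal{Q}$ if $\mathbb{R}^d \setminus H_i$ is path-connected, where $$H_i := \bigcup_{j=1,\, j \neq i}^{n} (\partial P + \mathcal{L}_i) \cap (\partial P + \mathcal{L}_j).$$ *)

(* Defs.v *)
From HB Require Import structures.
From mathcomp Require Import all_boot all_order all_algebra.
From mathcomp Require Import all_classical all_reals all_analysis.
Import Order.TTheory GRing.Theory Num.Theory.
Import numFieldNormedType.Exports.

Set Implicit Arguments.
Unset Strict Implicit.
Unset Printing Implicit Defensive.

Local Open Scope classical_set_scope.
Local Open Scope ring_scope.

Definition set_plus (V : zmodType) (A B : set V) : set V :=
  [set a + b | a in A & b in B].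

Definition boundary (T : topologicalType) (A : set T) : set T :=
  closure A `\` interior A.

Definition path_connected (R : realType) (T : topologicalType) (A : set T) :
    Prop :=
  forall x y, A x -> A y ->
    exists g : R -> T,
      [/\ {within `[0, 1], continuous g}, g 0 = x, g 1 = y
        & forall t, t \in `[0, 1] -> A (g t)].

Section Euclidean.
Context {R : realType} {d : nat}.
Local Notation V := 'rV[R]_d.
Implicit Types (A P L M : set V) (a v : V).

Definition is_lattice M : Prop :=
  exists2 b : d.-tuple V, basis_of fullv b &
    M = [set \sum_(i < d) tnth b i *~ z i | z in [set: 'I_d -> int]].

Definition is_translated_lattice L : Prop :=
  exists a M, is_lattice M /\ L = [set a + x | x in M].

Definition convex_hull A : set V := smallest (@convex_set R V) A.

(* A polytope may be empty or lower-dimensional; neither can k-tile. *)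
Definition is_convex_polytope P : Prop :=
  exists2 F : set V, finite_set F & P = convex_hull F.

(* A multiset is given by its multiplicity function. *)
Definition multiset : Type := V -> nat.

Implicit Types Lam : multiset.

Definition msupport Lam : set V := [set v | (0 < Lam v)%N].

Definition multiset_of_set A : multiset := fun v => (v \in A) : nat.

Definition multiset_restrict Lam A : multiset :=
  fun v => if v \in A then Lam v else 0%N.

Definition is_discrete Lam : Prop :=
  msupport Lam `<=` isolated (msupport Lam).

(* The sum is taken in the extended reals, hence needs no summability
   assumption. *)
Definition tiles P (k : nat) Lam : Prop :=
  [/\ (0 < k)%N, is_discrete Lam &
      forall v, ~ set_plus (boundary P) (msupport Lam) v ->
        \esum_(l in msupport Lam)
          ((Lam l)%:R * \1_[set p + l | p in P] v)%:E = (k%:R : R)%:E].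

Definition overlap P (n : nat) (L : 'I_n -> set V) (i : 'I_n) : set V :=
  \bigcup_(j in [set j | j != i])
    (set_plus (boundary P) (L i) `&` set_plus (boundary P) (L j)).

Definition in_general_position P (n : nat) (L : 'I_n -> set V) (i : 'I_n) :
    Prop :=
  path_connected R (~` overlap P L i).

End Euclidean.

Arguments multiset : clear implicits.

(* Main.v *)
(* Let f count the points of Lam in L i whose translate of P covers v, and g the
   remaining points of Lam.  Off [boundary P + L i] the function f is locally
   constant; off the boundary translates of the other lattices k - g is locally
   constant; where both conditions hold f = k - g.  The two open sets cover the
   complement of the overlap, which is path-connected, so f is a constant r.
   It is positive because P has nonempty interior and boundaries are nowhere
   dense.  Now Lam restricted to L i, seen as a weight on the lattice M, has
   convolution r with each indicator z |-> 1_P (v - z), v off the boundaries.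
   Convolving with two such indicators in both orders shows that r times the
   number of points of L i covering v does not depend on v. *)
Require Import Defs.
From HB Require Import structures.
From mathcomp Require Import all_boot all_order all_algebra.
From mathcomp Require Import finmap.
From mathcomp Require Import all_classical all_reals all_analysis.
Import Order.TTheory GRing.Theory Num.Theory.
Import numFieldNormedType.Exports.

Local Open Scope classical_set_scope.
Local Open Scope ring_scope.

Set Implicit Arguments.
Unset Strict Implicit.
Unset Printing Implicit Defensive.

(** * Boundaries, and local constancy along paths *)

Lemma set_plusP (V : zmodType) (A B : set V) v :
  set_plus A B v <-> exists2 b, B b & A (v - b).
Proof.
split=> [[a Aa [b Bb <-]]|[b Bb Ab]]; first by exists b; rewrite ?addrK.
by exists (v - b) => //; exists b; rewrite ?subrK.
Qed.

Lemma indic_translate (R : pzRingType) (V : zmodType) (P : set V) (l v : V) :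
  \1_[set p + l | p in P] v = \1_P (v - l) :> R.
Proof.
rewrite !indicE; congr (_ (nat_of_bool _)); apply/idP/idP; rewrite !inE.
  by case=> p Pp <-; rewrite addrK.
by move=> Pvl; exists (v - l); rewrite ?subrK.
Qed.

(** A point off the boundary lies in the interior or outside the closure. Both sets are open, avoid
    the boundary and decide membership in [A]. *)
Lemma near_off_boundary (T : topologicalType) (A : set T) (x : T) :
  ~ boundary A x -> \forall y \near x, ~ boundary A y /\ (A y <-> A x).
Proof.
move=> nbx; have [ix|nix] := pselect (interior A x).
  have Ax := interior_subset ix.
  have : nbhs x (interior A) by apply: open_nbhs_nbhs; split => //; exact: open_interior.
  apply: filterS => y iy; split; first by case.
  by split => // _; exact: interior_subset.
have ncx : ~ closure A x by move=> cx; apply: nbx.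
have : nbhs x (~` closure A).
  apply: open_nbhs_nbhs; split => //; apply: closed_openC; exact: closed_closure.
apply: filterS => y ncy; split; first by case.
by split => /subset_closure.
Qed.

Lemma closed_boundary (T : topologicalType) (A : set T) : closed (boundary A).
Proof.
rewrite /boundary setDE; apply: closedI; first exact: closed_closure.
by apply: open_closedC; exact: open_interior.
Qed.

(** A neighbourhood contained in the boundary would be contained in the closed set [A], so its
    centre would be interior to [A], which the boundary excludes. *)
Lemma interior_boundary_closed (T : topologicalType) (A : set T) :
  closed A -> interior (boundary A) = set0.
Proof.
move=> cA; rewrite -subset0 => x ix.
have [_] := interior_subset ix; apply.
apply: filterS ix => y [cy _]; exact: cA.
Qed.

(** If [f] differed at the ends of a path, the real indicator [h] of having left the value [f x]
    would be continuous from 0 to 1 and, by the intermediate value theorem, would take the value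
    1/2. No topology on [X] is involved. *)
Lemma path_connected_constant (R : realType) (T : topologicalType) (A : set T)
    (X : Type) (f : T -> X) :
  path_connected R A ->
  (forall x, A x -> \forall y \near x, A y -> f y = f x) ->
  forall x y, A x -> A y -> f x = f y.
Proof.
move=> pA lf x y Ax Ay.
have [g [gc g0 g1 gA]] := pA x y Ax Ay.
apply: contrapT => nfxy.
pose h (t : R) : R := if pselect (f (g t) = f x) then 0 else 1.
have h0 : h 0 = 0 by rewrite /h; case: pselect => // -[]; rewrite g0.
have h1 : h 1 = 1 by rewrite /h; case: pselect => //; rewrite g1 => fe; case: nfxy.
have hc : {within `[0, 1], continuous h}.
  apply/subspace_continuousP => t t01.
  have gt := (subspace_continuousP _ _).1 gc t t01 _ (lf _ (gA t t01)).
  apply: cvg_near_cst; near=> s; have s01 : s \in `[0, 1] by near: s; exact: near_withinT.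
  have : A (g s) -> f (g s) = f (g t) by near: s; exact: gt.
  by rewrite /h /from_subspace => ->//; exact: gA.
have [|t _] := IVT (v := 2^-1) (@ler01 R) hc.
  rewrite h0 h1 minEle maxEle ler01 invr_ge0 ler0n/= invf_le1//.
  by rewrite ler1n.
rewrite /h; case: pselect => _ /eqP.
  by rewrite eq_sym invr_eq0 pnatr_eq0.
by rewrite eq_sym invr_eq1 pnatr_eq1.
Unshelve. all: by end_near. Qed.

(** * Locally finite sets and lattices *)

(** Stronger than all points being isolated: accumulation points outside [A] are excluded too. *)
Definition locally_finite (R : realType) (V : normedModType R) (A : set V) :=
  forall r : R, finite_set (A `&` [set x | `|x| <= r]).

Lemma normr_coord_le (R : realType) (d : nat) (v : 'rV[R]_d) (j : 'I_d) :
  `|v ord0 j| <= `|v|.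
Proof.
rewrite [leRHS]/Num.norm /= mx_normrE.
by apply/bigmax_geP; right => /=; exists (ord0, j).
Qed.

Lemma linear_form_bounded (R : realType) (d : nat) (f : {scalar 'rV[R]_d}) :
  exists C : R, forall v, `|f v| <= C * `|v|.
Proof.
exists (\sum_(j < d) `|f (delta_mx ord0 j)|) => v.
rewrite {1}(row_sum_delta v) linear_sum mulr_suml.
apply: (le_trans (ler_norm_sum _ _ _)); apply: ler_sum => j _.
by rewrite linearZ/= normrM mulrC ler_wpM2l ?normr_coord_le.
Qed.

Lemma finite_int_box (d N : nat) :
  finite_set [set z : 'I_d -> int | forall i, `|z i| <= N%:Z].
Proof.
(* Shifting by [N] identifies the integers from [-N] to [N] with the [2N + 1] ordinals. *)
pose h (k : {ffun 'I_d -> 'I_N.*2.+1}) (i : 'I_d) : int := (k i)%:Z - N%:Z.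
apply: (@sub_finite_set _ _ (h @` setT)); last exact: finite_image.
move=> z /= zN; pose k i := absz (z i + N%:Z).
have zk i : 0 <= z i + N%:Z <= N.*2%:Z.
  by have := zN i; rewrite ler_norml -subr_ge0 opprK -addnn PoszD lerD2r.
have kN i : (k i < N.*2.+1)%N by rewrite ltnS -lez_nat gez0_abs; case/andP: (zk i).
exists [ffun i => Ordinal (kN i)] => //; apply/funext => i.
by rewrite /h ffunE /= gez0_abs ?addrK//; case/andP: (zk i).
Qed.

(** Coordinates in the basis are bounded linear forms, so a bound on [x] bounds the integer
    coordinates of [x - a], leaving finitely many choices. *)
Lemma translated_lattice_locally_finite (R : realType) (d : nat)
    (L : set 'rV[R]_d) :
  is_translated_lattice L -> locally_finite L.
Proof.
move=> [a [M [[b bb ->] ->]]] r.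
have [N NP] : exists N : nat, forall i v, `|coord b i v| <= N%:R * `|v|.
  have [C CP] := choice (fun i => linear_form_bounded (coord b i)).
  exists (\max_i (Num.truncn `|C i|).+1)%N => i v.
  apply: (le_trans (CP i v)); rewrite ler_wpM2r//.
  apply: (le_trans (ler_norm _)); apply: (le_trans (ltW (truncnS_gt _))).
  rewrite ler_nat; exact: (leq_bigmax i).
pose K := Num.bound (N%:R * (r + `|a|)).
apply: (@sub_finite_set _ _ ((fun z : 'I_d -> int => a + \sum_(i < d) tnth b i *~ z i)
    @` [set z : 'I_d -> int | forall i, `|z i| <= K%:Z])); last first.
  exact: finite_image (finite_int_box _ _).
move=> x [[_ [z _ <-] <-] /= xr]; exists z => // i.
have zE : coord b i (\sum_(i < d) tnth b i *~ z i) = (z i)%:~R.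
  under eq_bigr do rewrite (tnth_nth 0) -scaler_int.
  by rewrite coord_sum_free//; exact: (basis_free bb).
rewrite -(ler_int R) intr_norm -zE.
apply: (le_trans (NP _ _)).
apply: ltW; apply: (@le_lt_trans _ _ (N%:R * (r + `|a|))).
  rewrite ler_wpM2l// -[X in `|X|](addrK a) (le_trans (ler_normB _ _))//.
  by rewrite lerD2r addrC.
have N0 : 0 <= N%:R * (r + `|a|).
  by rewrite mulr_ge0// addr_ge0// (le_trans _ xr).
exact: archi_boundP.
Qed.

Lemma isolated_locally_finite (R : realType) (V : normedModType R) (A : set V) :
  locally_finite A -> A `<=` isolated A.
Proof.
move=> fA x Ax; split; first exact/mem_set.
have : \forall y \near x, A y -> y = x.
  have fB := fA (`|x| + 1).
  have /finite_seqP[s sE] := fB.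
  have h1 : \forall y \near x, forall z, z \in s -> z <> x -> y <> z.
    elim: s {sE} => [|z s ih]; first exact: nearW.
    have hz : \forall y \near x, z <> x -> y <> z.
      have [->|/eqP zx] := pselect (z = x); first exact: nearW.
      have : nbhs x (~` [set z]).
        apply: open_nbhs_nbhs; split; last by move/esym/eqP; apply/negP.
        apply: closed_openC; apply: compact_closed; first exact: norm_hausdorff.
        exact: compact_set1.
      by apply: filterS.
    near=> y => w; rewrite inE => /orP[/eqP->|ws]; first by near: y.
    by move: w ws; near: y.
  have h2 : \forall y \near x, `|y| <= `|x| + 1.
    near=> y; rewrite -[y](subrK x) (le_trans (ler_normD _ _))// addrC lerD2l.
    by rewrite distrC; near: y; exact: cvgr_dist_le.
  near=> y => Ay; apply: contrapT => yx.
  have ys : [set` s] y by rewrite -sE; split => //; near: y.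
  by have : forall z, z \in s -> z <> x -> y <> z; [near: y|move/(_ y ys yx)].
move=> nx; exists [set y | A y -> y = x] => //.
by apply/seteqP; split => [y [/= + Ay]|y ->]; [exact|split].
Unshelve. all: by end_near. Qed.

Lemma near_finite_set (T I : Type) (F : set_system T) (A : set I)
    (Q : I -> T -> Prop) :
  Filter F -> finite_set A -> (forall z, A z -> \forall y \near F, Q z y) ->
  \forall y \near F, forall z, A z -> Q z y.
Proof.
(* A classical choice structure on [I] allows the finite set to be listed as a sequence. *)
elim/Pchoice: I => I in A Q *.
move=> FF /finite_seqP[s ->]; elim: s => [|z s ih] QF; first exact: nearW.
have Qz : \forall y \near F, Q z y by apply: QF; rewrite /= mem_head.
have Qs : \forall y \near F, forall w, w \in s -> Q w y.
  by apply: ih => w ws; apply: QF; rewrite /= inE ws orbT.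
by near=> y => w; rewrite /= inE => /orP[/eqP->|]; [near: y|move: w; near: y].
Unshelve. all: by end_near. Qed.

(** * Translates of a bounded set along a locally finite set *)

(** If [C] bounds [P], such an [l] has norm at most [r + C]. The finite set serves all [u] of the
    ball at once, which gives neighbourhoods uniform in [l]. *)
Lemma finite_close_translates (R : realType) (V : normedModType R) (P L : set V)
    (r : R) :
  bounded_set P -> locally_finite L ->
  finite_set [set l | L l /\ exists2 u, `|u| <= r & closure P (u - l)].
Proof.
move=> /pinfty_ex_gt0[C _ PC] fL.
apply: sub_finite_set (fL (r + C)) => l [Ll [u ur cP]]; split => //=.
have : `|u - l| <= C.
  have /(_ _ cP) : closure P `<=` [set x | `|x| <= C].
    apply: (@subset_trans _ (closure [set x | `|x| <= C])).
      by apply: closureS => x /PC.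
    rewrite -(closure_id _).1//.
    apply: (@preimage_closed _ _ (fun x : V => `|x|) [set x : R | x <= C]); last first.
      exact: closed_le.
    by move=> x _; exact: norm_continuous.
  by [].
move=> ulC; rewrite -[l](subKr u) (le_trans (ler_normB _ _))//.
exact: lerD.
Qed.

Lemma near_off_boundary_translates (R : realType) (V : normedModType R)
    (P L : set V) (v : V) :
  bounded_set P -> locally_finite L -> ~ set_plus (boundary P) L v ->
  \forall u \near v, forall l, L l ->
    ~ boundary P (u - l) /\ (P (u - l) <-> P (v - l)).
Proof.
move=> bP fL nbv.
(* The radius [|v| + 1] covers every [u] within distance 1 of [v]; for [l] outside [A], neither
   [u - l] nor [v - l] is in the closure of [P]. *)
pose A := [set l | L l /\ exists2 u, `|u| <= `|v| + 1 & closure P (u - l)].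
have fA : finite_set A by exact: finite_close_translates.
have near_v : \forall u \near v, forall l, A l ->
    ~ boundary P (u - l) /\ (P (u - l) <-> P (v - l)).
  apply: near_finite_set => // l [Ll _].
  have /near_off_boundary nvl : ~ boundary P (v - l).
    by move=> bvl; apply: nbv; apply/set_plusP; exists l.
  have cl : u - l @[u --> v] --> v - l.
    by apply: cvgB; [exact: cvg_id|exact: cvg_cst].
  exact: (cl _ nvl).
have near_b : \forall u \near v, `|u| <= `|v| + 1.
  near=> u; rewrite -[u](subrK v) (le_trans (ler_normD _ _))// addrC lerD2l.
  by rewrite distrC; near: u; exact: cvgr_dist_le.
near=> u => l Ll; have [Al|nAl] := pselect (A l).
  by move: l {Ll} Al; near: u.
have uv : `|u| <= `|v| + 1 by near: u.
have ncu w : `|w| <= `|v| + 1 -> ~ closure P (w - l).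
  by move=> wv cP; apply: nAl; split => //; exists w.
split; first by move=> [cu _]; exact: ncu cu.
have vv : `|v| <= `|v| + 1 by rewrite lerDl.
by split => /subset_closure => [/(ncu u uv)|/(ncu v vv)].
Unshelve. all: by end_near. Qed.

Lemma open_translate (R : realType) (V : normedModType R) (U : set V) (l : V) :
  open U -> open [set v | U (v - l)].
Proof.
move=> oU; apply: ((continuousP (fun v : V => v - l)).1 _ _ oU) => v.
by apply: cvgB; [exact: cvg_id|exact: cvg_cst].
Qed.

(** Only finitely many boundary translates meet a bounded open set. Each is closed with empty
    interior, so removing them one at a time leaves a nonempty open set. *)
Lemma dense_off_boundary_translates (R : realType) (V : normedModType R)
    (P L : set V) :
  closed P -> bounded_set P -> locally_finite L ->
  dense (~` set_plus (boundary P) L).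
Proof.
move=> cP bP fL O [v Ov] oO.
have off (s : seq V) (U : set V) : open U -> U !=set0 ->
    exists2 u, U u & forall l, l \in s -> ~ boundary P (u - l).
  elim: s U => [|l s ih] U oU U0; first by case: U0 => u Uu; exists u.
  have [] := ih (U `&` ~` [set u | boundary P (u - l)]).
  - apply: openI => //.
    by apply: (@open_translate _ _ (~` boundary P)); exact/closed_openC/closed_boundary.
  - apply: contrapT => nU; case: U0 => u Uu.
    have : interior (boundary P) (u - l).
      have cu : w + l @[w --> u - l] --> u.
        by rewrite -[X in _ --> X](subrK l); apply: cvgD; [exact: cvg_id|exact: cvg_cst].
      have nU' : nbhs (u - l) ((fun w => w + l) @^-1` U).
        by apply: cu; exact: open_nbhs_nbhs.
      apply: filterS nU' => w Uw; apply: contrapT => nbw; apply: nU.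
      by exists (w + l); split => //=; rewrite addrK.
    by rewrite interior_boundary_closed.
  move=> u [Uu nbu] su; exists u => // w; rewrite inE => /orP[/eqP->//|].
  exact: su.
have /finite_seqP[s sE] := finite_close_translates (`|v| + 1) bP fL.
have [] := off s (O `&` [set u | `|u| < `|v| + 1]).
- apply: openI => //; have -> : [set u : V | `|u| < `|v| + 1] = ball 0 (`|v| + 1).
    by apply/seteqP; split => u; rewrite /= -ball_normE/= sub0r normrN.
  exact: ball_open.
- by exists v; split => //=; rewrite ltrDl.
move=> u [Ou /= uv] su; exists u; split => //.
move/set_plusP => [l Ll bul]; apply: (su l) => //.
suff: [set` s] l by [].
by rewrite -sE; split => //; exists u; [exact: ltW|case: bul].
Qed.

(** * Compactness of polytopes *)

(** Keeping the weights unnormalized lets the induction split off the first point without rescaling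
    the others. *)
Lemma convex_set_barycenter (R : realType) (V : lmodType R) (A : set V) (n : nat)
    (w : 'I_n -> R) (x : 'I_n -> V) :
  @convex_set R V A -> (forall i, 0 <= w i) -> 0 < \sum_i w i ->
  (forall i, A (x i)) -> A ((\sum_i w i)^-1 *: \sum_i w i *: x i).
Proof.
move=> cA; elim: n w x => [|n ih] w x w0; first by rewrite big_ord0 ltxx.
rewrite !big_ord_recl; set c := \sum_(i < n) _; set z := \sum_(i < n) _.
move=> s0 Ax; have := w0 ord0; set c0 := w ord0 in s0 * => c00.
have : 0 <= c by exact: sumr_ge0.
rewrite le_eqVlt => /orP[/eqP c_eq0|c_gt0].
  (* When the remaining weights sum to 0 they all vanish, and the barycenter is the first point. *)
  have z0 : z = 0.
    apply: big1 => i _; move/esym/eqP: c_eq0.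
    rewrite psumr_eq0// => /allP/(_ i); rewrite mem_index_enum => /(_ isT)/eqP ->.
    exact: scale0r.
  by move: s0; rewrite -c_eq0 z0 !addr0 => s0; rewrite scalerA mulVf ?gt_eqF ?scale1r.
have /= Ay := ih _ (fun i => x (lift ord0 i)) (fun i => w0 _) c_gt0 (fun i => Ax _).
have l0 : 0 <= c0 / (c0 + c) by rewrite divr_ge0// ltW.
have l1 : c0 / (c0 + c) <= 1 by rewrite ler_pdivrMr// mul1r lerDl ltW.
have := cA _ _ (Itv01 l0 l1) (mem_set (Ax ord0)) (mem_set Ay) => /set_mem.
set y := (\sum_i _)^-1 *: _.
rewrite [X in A X -> _](_ : _ = (c0 / (c0 + c)) *: x ord0 + (1 - c0 / (c0 + c)) *: y)//.
congr A; rewrite scalerDr !scalerA; congr (_ *: _ + _ *: _).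
  by rewrite mulrC.
have sN0 : c0 + c != 0 by rewrite gt_eqF.
rewrite -{1}(divff sN0) -mulrBl [c0 + c]addrC addrK mulrAC divff ?gt_eqF// mul1r.
by rewrite addrC.
Qed.

(** The hull is the image of the standard simplex [D], a closed subset of a compact cube, under the
    continuous map [f] sending weights to combinations. *)
Lemma compact_convex_hull (R : realType) (d : nat) (F : set 'rV[R]_d) :
  finite_set F -> compact (convex_hull F).
Proof.
move=> /finite_seqP[s ->]; pose n := size s.
pose D := [set w : 'rV[R]_n | forall i, `[0, 1]%classic (w ord0 i)]
  `&` [set w | \sum_i w ord0 i = 1].
pose f (w : 'rV[R]_n) : 'rV[R]_d := \sum_i w ord0 i *: s`_i.
have cD : compact D.
  apply: compact_closedI.
    apply: (@rV_compact R n (fun=> `[0, 1]%classic)) => _.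
    exact: segment_compact.
  apply: (@preimage_closed _ _ (fun w : 'rV[R]_n => \sum_i w ord0 i) [set 1]).
    move=> w _; apply: (continuous_big add_continuous) => i _.
    exact: coord_continuous.
  by apply: compact_closed; [exact: norm_hausdorff|exact: compact_set1].
suff -> : convex_hull [set` s] = f @` D.
  apply: continuous_compact cD; apply: continuous_subspaceT.
  apply: (continuous_big add_continuous) => i _ w.
  exact: (@cvgZr_tmp R _ _ (nbhs w) _ _ _ _ (@coord_continuous R 1 n ord0 i w)).
apply/seteqP; split.
  (* The image of [D] is convex and contains each point of [s], as the image of a unit vector. *)
  apply: smallest_sub.
    move=> x y l /set_mem[u [u01 u1] <-] /set_mem[v [v01 v1] <-]; apply/mem_set.
    exists ((l%:num : R) *: u + (1 - (l%:num : R)) *: v).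
      split=> [i|] /=.
        have := u01 i; have := v01 i; rewrite /= !in_itv/= !mxE.
        move=> /andP[v0 v1'] /andP[u0 u1'].
        have l0 : 0 <= l%:num by []. have l1 : l%:num <= 1 by [].
        apply/andP; split; first by rewrite addr_ge0// mulr_ge0// subr_ge0.
        have l1' : 0 <= 1 - (l%:num : R) by rewrite subr_ge0.
        by rewrite (le_trans (lerD (ler_piMr l0 u1') (ler_piMr l1' v1')))// subrKC.
      under eq_bigr do rewrite !mxE.
      by rewrite big_split/= -!mulr_sumr u1 v1 !mulr1 subrKC.
    rewrite /f; under eq_bigr do rewrite !mxE scalerDl -!scalerA.
    by rewrite big_split/= -!scaler_sumr.
  move=> x /= xs; have ix : (index x s < n)%N by rewrite index_mem.
  exists (delta_mx ord0 (Ordinal ix)).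
    split=> [i|] /=.
      rewrite in_itv/= mxE ler0n.
      by case: (_ == _); case: (_ == _); rewrite ?lexx ?ler01.
    rewrite (bigD1 (Ordinal ix))//= mxE !eqxx big1 ?addr0// => i /negPf ii.
    by rewrite mxE ii andbF.
  rewrite /f (bigD1 (Ordinal ix))//= mxE !eqxx big1 ?addr0 => [|i /negPf ii].
    by rewrite scale1r nth_index.
  by rewrite mxE ii andbF scale0r.
move=> _ [w [w01 w1] <-] A [cA sA].
have := @convex_set_barycenter _ _ A n (fun i => w ord0 i) (fun i => s`_i) cA.
rewrite w1 invr1 scale1r; apply => // i.
  by have := w01 i; rewrite /= in_itv/= => /andP[].
by apply: sA; rewrite /= mem_nth.
Qed.

(** * Sums of nonnegative families *)

(** Finite subsums give one inequality; for [c > 0] the other is the same inequality for the factor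
    [c^-1]. *)
Lemma esumZl (R : realType) (T : choiceType) (I : set T) (a : T -> \bar R)
    (c : R) :
  0 <= c -> (forall i, I i -> (0 <= a i)%E) ->
  (\esum_(i in I) (c%:E * a i) = c%:E * \esum_(i in I) a i)%E.
Proof.
move=> c0 a0.
have le_sum (b : T -> \bar R) (e : R) : 0 <= e -> (forall i, I i -> (0 <= b i)%E) ->
    (\esum_(i in I) (e%:E * b i) <= e%:E * \esum_(i in I) b i)%E.
  move=> e0 b0; apply: ge_ereal_sup => _ [X [fX XI] <-].
  have -> : (\sum_(i \in X) (e%:E * b i) = e%:E * \sum_(i \in X) b i)%E.
    rewrite !fsbig_finite//= big_seq [in RHS]big_seq ge0_sume_distrr// => i.
    by rewrite in_fset_set// => /set_mem/XI/b0.
  rewrite lee_pmul//; last by apply: ereal_sup_ubound; exists X.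
  - rewrite fsbig_finite//= big_seq sume_ge0// => i.
    by rewrite in_fset_set// => /set_mem/XI/b0.
apply/eqP; rewrite eq_le le_sum//=.
have [->|cN0] := eqVneq c 0.
  by rewrite mul0e esum_ge0// => i _; rewrite mul0e.
have {cN0}c_gt0 : 0 < c by rewrite lt_neqAle eq_sym cN0.
rewrite -lee_pdivlMl//; apply: le_trans (le_sum _ _ _ _).
- by apply: le_esum => i Ii; rewrite muleA -EFinM mulVf ?gt_eqF// mul1e.
- by rewrite invr_ge0 ltW.
- by move=> i Ii; rewrite mule_ge0 ?a0// lee_fin ltW.
Qed.

Lemma exchange_esum (R : realType) (T1 T2 : choiceType) (I : set T1) (J : set T2)
    (a : T1 -> T2 -> \bar R) :
  (forall i j, I i -> J j -> (0 <= a i j)%E) ->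
  \esum_(i in I) \esum_(j in J) a i j = \esum_(j in J) \esum_(i in I) a i j.
Proof.
move=> a0; rewrite esum_esum//.
rewrite (@esum_esum _ _ _ _ (fun=> I) (fun j i => a i j)); last first.
  by move=> j i Jj Ii; exact: a0.
apply: (reindex_esum _ _ (fun k : T2 * T1 => (k.2, k.1)) (fun k => a k.1 k.2)).
split=> [[i j] [/= Ji Ij]//|[i j] [i' j'] _ _ [-> ->]//|[i j] [/= Ii Jj]].
by exists (j, i).
Qed.

(** * Weighted coverage by translates *)

(** The convolution of the weight [w] on [L] with the indicator of [P]: the number of translates
    [P + l] containing [v], with multiplicity. *)
Definition coverage (R : realType) (V : zmodType) (P L : set V) (w : V -> nat)
    (v : V) : \bar R :=
  \esum_(l in L) ((w l)%:R * \1_P (v - l))%:E.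

Lemma coverage_term_ge0 (R : realType) (V : zmodType) (P : set V) (n : nat) (v : V) :
  (0 <= (n%:R * \1_P v : R)%:E)%E.
Proof. by rewrite lee_fin mulr_ge0// indicE. Qed.

Lemma coverage_ge0 (R : realType) (V : zmodType) (P L : set V) (w : V -> nat) (v : V) :
  (0 <= coverage R P L w v)%E.
Proof. by apply: esum_ge0 => l _; exact: coverage_term_ge0. Qed.

(** The set [L'] controlling the boundaries may exceed the set [L] of summation, so that the lemma
    also applies to a set with some points removed. *)
Lemma near_coverage (R : realType) (V : normedModType R) (P L L' : set V)
    (w : V -> nat) (v : V) :
  bounded_set P -> locally_finite L' -> L `<=` L' ->
  ~ set_plus (boundary P) L' v ->
  \forall u \near v, ~ set_plus (boundary P) L' u /\
    coverage R P L w u = coverage R P L w v.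
Proof.
move=> bP fL' LL' nbv; have := near_off_boundary_translates bP fL' nbv.
apply: filterS => u uv; split; first by move=> /set_plusP[l /uv[]].
apply: eq_esum => l /LL'/uv[_ Puv]; rewrite !indicE.
by have -> : (u - l \in P) = (v - l \in P) by apply/idP/idP => /set_mem/Puv/mem_set.
Qed.

Lemma coverage_constant (R : realType) (V : normedModType R) (P L L' : set V)
    (w : V -> nat) (k : nat) :
  bounded_set P -> locally_finite L -> locally_finite L' ->
  path_connected R
    (~` (set_plus (boundary P) L `&` set_plus (boundary P) L')) ->
  (forall v, ~ set_plus (boundary P) L v -> ~ set_plus (boundary P) L' v ->
    coverage R P (L `|` L') w v = (k%:R)%:E) ->
  forall x y, ~ set_plus (boundary P) L x -> ~ set_plus (boundary P) L y ->
    coverage R P L w x = coverage R P L w y.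
Proof.
move=> bP fL fL' pc tot.
set S := set_plus _ L in pc tot *; set S' := set_plus _ L' in pc tot *.
(* Points common to [L] and [L'] are counted once, in [f]. The finite total [k] makes [g v] finite,
   so that the subtraction is legitimate. *)
pose f := coverage R P L w; pose g := coverage R P (L' `\` L) w.
have fg v : ~ S v -> ~ S' v -> f v = (k%:R%:E - g v)%E.
  move=> Sv S'v; have := tot v Sv S'v.
  rewrite /coverage (esumID L) => [|l _]; last exact: coverage_term_ge0.
  rewrite setUK -setDE setDUl setDv set0U -/(coverage R P L w v) -/(coverage _ _ _ _ _).
  rewrite -/(f v) -/(g v) => e; rewrite -e addeK//.
  have : (f v + g v)%E \is a fin_num by rewrite e.
  by rewrite fin_numD => /andP[].
(* [phi] glues the two expressions: it is [f] off [S] and [k - g] off [S'], hence locally constant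
   on both open sets. *)
pose phi v : \bar R := if pselect (S v) then (k%:R%:E - g v)%E else f v.
have phiE v : ~ S v -> phi v = f v by rewrite /phi; case: pselect.
have phiE' v : ~ S' v -> phi v = (k%:R%:E - g v)%E.
  by rewrite /phi; case: pselect => // Sv S'v; exact: fg.
move=> x y Sx Sy; rewrite -/(f x) -/(f y) -!phiE//.
apply: (path_connected_constant pc); [|by case..].
move=> z Az; have [Sz|Sz] := pselect (S z); last first.
  have := @near_coverage R V P L L w z bP fL (fun _ h => h) Sz.
  by apply: filterS => u [Su fu] _; rewrite !phiE.
have S'z : ~ S' z by move=> ?; apply: Az.
have := @near_coverage R V P (L' `\` L) L' w z bP fL' (@subDsetl _ _ _) S'z.
by apply: filterS => u [Su gu] _; rewrite !phiE'// /g gu.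
Qed.

(* Evaluates the convolution of w with the two indicators [z |-> 1_P (x - z)]
   and [z |-> 1_P (y - z)] of M in both orders. *)
Lemma coverage_count_proportional (R : realType) (V : zmodType) (M P : set V)
    (w : V -> nat) (m : R) (x y : V) :
  (forall a b, M a -> M b -> M (a - b)) ->
  0 <= m ->
  (forall z, M z -> coverage R P M w (x + z) = m%:E) ->
  (forall z, M z -> coverage R P M w (y + z) = m%:E) ->
  (m%:E * coverage R P M (fun=> 1%N) x = m%:E * coverage R P M (fun=> 1%N) y)%E.
Proof.
move=> MB m0 hx hy.
(* Each factor [m] is expanded as the coverage at [u + z], with [z] running over the points that
   count [v]. *)
have conv (u v : V) : (forall z, M z -> coverage R P M w (u + z) = m%:E) ->
    (m%:E * coverage R P M (fun=> 1%N) v = \esum_(l in M) \esum_(z in M)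
      ((w l)%:R * \1_P (u + z - l) * \1_P (v - z))%:E)%E.
  move=> hu; rewrite exchange_esum => [|l z _ _]; last first.
    by rewrite lee_fin !mulr_ge0// indicE.
  rewrite /coverage -esumZl//.
  apply: eq_esum => z Mz; rewrite -(hu z Mz) /coverage mul1r muleC -esumZl//.
  by apply: eq_esum => l _; rewrite -EFinM mulrC.
rewrite (conv y x hy) (conv x y hx); apply: eq_esum => l Ml.
(* The involution [z |-> l - z] of [M] exchanges the roles of [x] and [y]. *)
rewrite (reindex_esum M M (fun z => l - z)); last first.
  split=> [z Mz|a b _ _ /subrI//|z Mz]; first exact: MB.
  by exists (l - z); [exact: MB|rewrite subKr].
apply: eq_esum => z Mz; congr EFin; rewrite -!mulrA; congr (_ * _).
rewrite mulrC; congr (\1_P _ * \1_P _); first by rewrite opprB addrA.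
by rewrite addrA addrAC addrK.
Qed.

Lemma coverage_count_finite (R : realType) (V : normedModType R) (P L : set V) (v : V) :
  bounded_set P -> locally_finite L ->
  exists n : nat, coverage R P L (fun=> 1%N) v = (n%:R)%:E.
Proof.
move=> bP fL; pose A := L `&` [set l | P (v - l)].
have fA : finite_set A.
  apply: sub_finite_set (finite_close_translates `|v| bP fL) => l [Ll Pl].
  by split=> //; exists v => //; exact: subset_closure.
exists #|` fset_set A|.
have -> : coverage R P L (fun=> 1%N) v = \esum_(l in A) 1%E.
  rewrite /A esum_mkcondr; apply: eq_esum => l _; rewrite mul1r indicE.
  have -> : (l \in [set l | P (v - l)]) = (v - l \in P).
    by apply/idP/idP => /set_mem/mem_set.
  by case: ifP.
rewrite esum_fset// fsbig_finite//= sumEFin big_const_seq.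
by rewrite count_predT iter_addr_0.
Qed.

(** * Tilings and translated lattices in terms of coverage *)

(** Enlarging the support to [A] only adds terms of multiplicity 0. *)
Lemma tiles_coverage (R : realType) (d : nat) (P : set 'rV[R]_d) (k : nat)
    (Lam : multiset R d) (A : set 'rV[R]_d) (v : 'rV[R]_d) :
  tiles P k Lam -> msupport Lam `<=` A -> ~ set_plus (boundary P) A v ->
  coverage R P A Lam v = (k%:R)%:E.
Proof.
move=> [_ _ tP] sA nbv; rewrite -(tP v) => [|/set_plusP[l /sA Al bl]]; last first.
  by apply: nbv; apply/set_plusP; exists l.
rewrite /coverage esum_mkcond [RHS]esum_mkcond; apply: eq_esum => l _.
rewrite indic_translate; have [ls|ls] := boolP (l \in msupport Lam).
  by rewrite (mem_set (sA _ (set_mem ls))).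
have -> : Lam l = 0%N.
  by apply/eqP; rewrite -leqn0 leqNgt; apply: contra ls => ls; exact: mem_set.
by rewrite mul0r; case: ifP.
Qed.

Lemma translated_lattice_subgroup (R : realType) (d : nat) (L : set 'rV[R]_d) :
  is_translated_lattice L ->
  exists a M, [/\ L = [set a + x | x in M] & forall x y, M x -> M y -> M (x - y)].
Proof.
move=> [a [M [[b _ ->] ->]]]; exists a; eexists; split; first by [].
move=> _ _ [z _ <-] [z' _ <-]; exists (fun i => z i - z' i) => //.
by rewrite -sumrB; apply: eq_bigr => i _; rewrite mulrzBr.
Qed.

Lemma coverage_translate (R : realType) (V : zmodType) (P M : set V) (w : V -> nat)
    (a v : V) :
  coverage R P [set a + x | x in M] w v = coverage R P M (fun x => w (a + x)) (v - a).
Proof.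
rewrite /coverage (reindex_esum M _ (fun x => a + x)).
  by apply: eq_esum => x _; rewrite opprD addrA.
by split=> [x Mx|x y _ _ /addrI//|_ [x Mx <-]]; exists x.
Qed.

Lemma msupport_of_set (R : realType) (d : nat) (L : set 'rV[R]_d) :
  msupport (multiset_of_set L) = L.
Proof.
by apply/seteqP; split => x; rewrite /msupport /= /multiset_of_set lt0b in_setE.
Qed.

Lemma is_discrete_locally_finite (R : realType) (d : nat) (L : set 'rV[R]_d) :
  locally_finite L -> is_discrete (multiset_of_set L).
Proof.
move=> fL; rewrite /is_discrete.
by rewrite msupport_of_set; exact: isolated_locally_finite.
Qed.

Lemma locally_finite_bigcup (R : realType) (V : normedModType R) (n : nat)
    (L : 'I_n -> set V) (D : set 'I_n) :
  (forall i, locally_finite (L i)) -> locally_finite (\bigcup_(i in D) L i).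
Proof.
move=> fL r; rewrite setI_bigcupl; apply: bigcup_finite => [|i _]; last exact: fL.
exact: finite_finset.
Qed.

(* If the interior of P were empty, P would equal its boundary and a point off
   all boundary translates would be uncovered. *)
Lemma tiles_interior_nonempty (R : realType) (d : nat) (P : set 'rV[R]_d) (k : nat)
    (Lam : multiset R d) (A : set 'rV[R]_d) :
  closed P -> bounded_set P -> locally_finite A -> tiles P k Lam ->
  msupport Lam `<=` A -> interior P !=set0.
Proof.
move=> cP bP fA tP sA; apply: contrapT => /nonemptyPn iP0.
have bdE : boundary P = P by rewrite /boundary iP0 setD0 -(closure_id P).1.
have [v [_ nbv]] := dense_off_boundary_translates cP bP fA (ex_intro _ 0 I) openT.
have := tiles_coverage tP sA nbv; rewrite /coverage esum1 => [/eqP|l Al].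
  by case: tP => k0 _ _; rewrite eqe eq_sym pnatr_eq0 -leqn0 leqNgt k0.
rewrite indicE memNset ?mulr0// -bdE => bl.
by apply: nbv; apply/set_plusP; exists l.
Qed.

(** * Tiling by one translated lattice in general position *)

Unset Implicit Arguments.

Theorem theorem1p2 (R : realType) (d : nat) (P : set 'rV[R]_d) (k : nat)
    (Lam : multiset R d) (n : nat) (L : 'I_n -> set 'rV[R]_d) (i : 'I_n)
    (hP : is_convex_polytope P)
    (htile : tiles P k Lam)
    (hL : forall j, is_translated_lattice (L j))
    (hQ : msupport Lam `<=` \bigcup_j L j)
    (hgen : in_general_position P L i)
    (hmeet : msupport (multiset_restrict Lam (L i)) !=set0) :
  exists m : nat, (0 < m)%N /\ tiles P m (multiset_of_set (L i)).
Proof.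
have cptP : compact P by case: hP => F fF ->; exact: compact_convex_hull.
have cP : closed P by apply: compact_closed cptP; exact: norm_hausdorff.
have bP : bounded_set P by exact: compact_bounded.
have fL j := translated_lattice_locally_finite (hL j).
set S := set_plus (boundary P) (L i).
(* Merging the other translated lattices reduces the problem to two sets; [overlap] becomes the
   intersection of their boundary translates. *)
pose L' := \bigcup_(j in [set j | j != i]) L j.
have fL' : locally_finite L' by exact: locally_finite_bigcup.
have LL' : \bigcup_j L j `<=` L i `|` L'.
  move=> x [j _ Ljx]; have [<-|ji] := eqVneq j i; first by left.
  by right; exists j.
have cst x y : ~ S x -> ~ S y -> coverage R P (L i) Lam x = coverage R P (L i) Lam y.
  apply: (@coverage_constant R _ P (L i) L' Lam k) => //.
    suff <- : overlap P L i = S `&` set_plus (boundary P) L' by [].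
    rewrite /overlap -setI_bigcupr; congr (_ `&` _); apply/seteqP; split => v.
      move=> [j ji /set_plusP[l Ll bl]]; apply/set_plusP.
      by exists l => //; exists j.
    move=> /set_plusP[l [j ji Ll] bl]; exists j => //; apply/set_plusP.
    by exists l.
  move=> v Sv S'v; apply: (tiles_coverage htile (subset_trans hQ LL')).
  move=> /set_plusP[l [Ll|L'l] bl]; [apply: Sv|apply: S'v].
    by apply/set_plusP; exists l.
  by apply/set_plusP; exists l.
(* By density, [v0] can be taken in the interior of [P + l0] for a point [l0] of [L i] with positive
   multiplicity. *)
have [v0 Sv0 pos] : exists2 v, ~ S v & (0 < coverage R P (L i) Lam v)%E.
  have [l0] := hmeet; rewrite /msupport /= /multiset_restrict.
  case: ifP => // /set_mem Ll0 Lam0.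
  have [p ip] := tiles_interior_nonempty cP bP (locally_finite_bigcup setT fL) htile hQ.
  pose O := [set x | interior P (x - l0)].
  have O0 : O !=set0 by exists (p + l0); rewrite /O /= addrK.
  have oO : open O by exact: open_translate (@open_interior _ P).
  have [v [iv Sv]] := dense_off_boundary_translates cP bP (fL i) O0 oO.
  exists v => //; apply: (@lt_le_trans _ _ (Lam l0)%:R%:E).
    by rewrite lte_fin ltr0n.
  apply: esum_ge; exists [set l0]; first by split; [exact: finite_set1|move=> _ ->].
  by rewrite fsbig_set1 indicE (mem_set (interior_subset iv)) mulr1.
(* The tiling identity may fail at [v0], which can lie on boundary translates of other lattices. The
   bound by [k] is obtained at [v1], off all of them, and carried back by constancy. *)
have [r rE r0] : exists2 r : R, coverage R P (L i) Lam v0 = r%:E & 0 < r.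
  have [v1 [_ nbv1]] := dense_off_boundary_translates cP bP
    (locally_finite_bigcup setT fL) (ex_intro _ 0 I) openT.
  have Sv1 : ~ S v1.
    by move=> /set_plusP[l Ll bl]; apply: nbv1; apply/set_plusP; exists l => //; exists i.
  have le_k : (coverage R P (L i) Lam v0 <= k%:R%:E)%E.
    rewrite (cst v0 v1 Sv0 Sv1) -(tiles_coverage htile hQ nbv1).
    rewrite [leRHS](esumID (L i)) => [|l _]; last exact: coverage_term_ge0.
    have -> : (\bigcup_j L j) `&` L i = L i.
      by apply/setIidr => x Lx; exists i.
    by apply: leeDl; apply: esum_ge0 => l _; exact: coverage_term_ge0.
  have fin : coverage R P (L i) Lam v0 \is a fin_num.
    by rewrite ge0_fin_numE ?coverage_ge0// (le_lt_trans le_k)// ltry.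
  exists (fine (coverage R P (L i) Lam v0)); first by rewrite fineK.
  by rewrite fine_gt0// pos ltey_eq fin.
have [a [M [LE MB]]] := translated_lattice_subgroup (hL i).
have [m mE] := coverage_count_finite v0 bP (fL i).
have count v : ~ S v -> coverage R P (L i) (fun=> 1%N) v = m%:R%:E.
  move=> Sv; rewrite -mE.
  (* [S] is invariant under [M], so [x + z] stays off [S]; subtracting [a] turns sums over [L i]
     into sums over the group [M]. *)
  have hcov x : ~ S x -> forall z, M z ->
      coverage R P M (fun y => Lam (a + y)) (x - a + z) = r%:E.
    move=> Sx z Mz; rewrite addrAC -coverage_translate -LE -rE; apply: cst => //.
    move=> /set_plusP[l]; rewrite LE => -[y My <-] bl; apply: Sx; apply/set_plusP.
    exists (a + (y - z)); first by rewrite LE; exists (y - z) => //; exact: MB.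
    by rewrite [a + _]addrA opprB addrA.
  have := coverage_count_proportional MB (ltW r0) (hcov v Sv) (hcov v0 Sv0).
  rewrite LE !coverage_translate.
  move=> /(congr1 (fun x => (r^-1%:E * x)%E)).
  by rewrite !muleA -!EFinM mulVf ?gt_eqF// !mul1e.
have m_gt0 : (0 < m)%N.
  (* If [m] were 0, no translate by [L i] would cover [v0], and the weighted coverage there would
     vanish too. *)
  rewrite lt0n; apply/eqP => m0; move: mE; rewrite m0 => c0.
  suff c1 : coverage R P (L i) Lam v0 = 0%E by rewrite c1 ltxx in pos.
  apply: esum1 => l Ll; suff : \1_P (v0 - l) = 0 :> R by move=> ->; rewrite mulr0.
  rewrite indicE; case: (boolP (v0 - l \in P)) => // Pl.
  suff : (1 <= coverage R P (L i) (fun=> 1%N) v0)%E by rewrite c0 lee_fin ler10.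
  apply: esum_ge; exists [set l]; first by split; [exact: finite_set1|move=> _ ->].
  by rewrite fsbig_set1 indicE Pl mulr1.
exists m; split=> //; split=> //; first exact: is_discrete_locally_finite.
move=> v; rewrite msupport_of_set => Sv; rewrite -(count v Sv).
apply: eq_esum => l Ll; rewrite indic_translate /multiset_of_set.
by rewrite (mem_set Ll).
Qed.
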